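(* Let $X,Y\subset\mathbb{R}$ be compact intervals and let $f:X\times Y\to\mathbb{R}$ be continuous. Assume that: 1. for every fixed $y\in Y$, the map $x\mapsto f(x,y)$ is convex on $X$; 2. for every fixed $x\in X$, the map $y\mapsto f(x,y)$ is concave on $Y$; 3. the mixed Monge condition $\partial_{xx}\bigl(-\partial_{yy}f\bigr)\ge 0$ holds in the sense of distributions on $X\times Y$. Then for every $\varepsilon>0$ there exist an integer $N\ge 1$, convex functions $e_1,\dots,e_N:X\to[0,\infty)$, concave functions $a_1,\dots,a_N:Y\to[0,\infty)$, and a concave function $G:Y\to\mathbb{R}$ such that $$\sup_{(x,y)\in X\times Y}\left|f(x,y)-\left(\sum_{i=1}^N e_i(x)a_i(y)+G(y)\right)\right|<\varepsilon .$$
   Context: The inequality $\partial_{xx}(-\partial_{yy}f)\ge 0$ in the sense of distributions on $X\times Y$ means that for every nonnegative smooth test function $\varphi$ compactly supported in the interior of $X\times Y$ one has $-\int_{X\times Y} f(x,y)\,\partial_{xx}\partial_{yy}\varphi(x,y)\,dx\,dy\ge 0$. *)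

(* Defs.v *)
From HB Require Import structures.
From mathcomp Require Import all_boot all_order all_algebra.
From mathcomp Require Import all_classical all_reals all_analysis.

Set Implicit Arguments.
Unset Strict Implicit.
Unset Printing Implicit Defensive.

Import Order.TTheory GRing.Theory Num.Theory.
Import numFieldNormedType.Exports.

Local Open Scope classical_set_scope.
Local Open Scope ring_scope.

(* Functions on a subset [D] of the line (or the plane) are total functions;
   only their values on [D] are constrained by the notions below. *)

Definition concave_function (R : realType) (D : set R) (g : R -> R) : Prop :=
  convex_function (D : set R^o) (fun x => - g x).

Definition continuous_on2 (R : realType) (D : set (R * R))
    (f : R -> R -> R) : Prop :=
  {within D, continuous (fun z : R * R => f z.1 z.2)}.

Definition dx (R : realType) (phi : R -> R -> R) : R -> R -> R :=
  fun x y => derive1 (phi ^~ y) x.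

Definition dy (R : realType) (phi : R -> R -> R) : R -> R -> R :=
  fun x y => derive1 (phi x) y.

(* The operator [derive1] is total, so the existence of each partial derivative
   is required separately. *)
Fixpoint Ck (R : realType) (k : nat) (phi : R -> R -> R) : Prop :=
  continuous (fun z : R * R => phi z.1 z.2) /\
  if k is k'.+1 then
    [/\ forall x y, derivable (phi ^~ y) x 1,
        forall x y, derivable (phi x) y 1,
        Ck k' (dx phi)
      & Ck k' (dy phi)]
  else True.

Definition smooth (R : realType) (phi : R -> R -> R) : Prop :=
  forall k, Ck k phi.

Definition tsupport (R : realType) (phi : R -> R -> R) : set (R * R) :=
  closure [set z | phi z.1 z.2 != 0].

Definition nonneg_test_function (R : realType) (D : set (R * R))
    (phi : R -> R -> R) : Prop :=
  [/\ smooth phi,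
      compact (tsupport phi),
      tsupport phi `<=` interior D
    & forall x y, 0 <= phi x y].

(* [d_xx (- d_yy f) >= 0] in the sense of distributions on [D]. For [f]
   continuous on a compact [D] the integrand is continuous on [D], so the
   integral is finite and [Rintegral] does not take a default value. *)
Definition mixed_monge (R : realType) (D : set (R * R))
    (f : R -> R -> R) : Prop :=
  forall phi : R -> R -> R, nonneg_test_function D phi ->
    0 <= - (\int[(@lebesgue_measure R \x @lebesgue_measure R)%E]_(z in D)
              (f z.1 z.2 * dx (dx (dy (dy phi))) z.1 z.2)).

(* Main.v *)
Require Import Defs.
From mathcomp Require Import all_boot all_order all_algebra.
From mathcomp Require Import all_classical all_reals all_analysis.
From mathcomp Require Import measurable_realfun.
From mathcomp Require Import ring lra.

Set Implicit Arguments.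
Unset Strict Implicit.
Unset Printing Implicit Defensive.

Import Order.TTheory GRing.Theory Num.Theory.
Import numFieldNormedType.Exports.

Local Open Scope classical_set_scope.
Local Open Scope ring_scope.

(** The proof interpolates [f] in the variable [y] alone.

    Cut [[y0, y1]] into [n+1] cells of length [h] by nodes [y_0, ..., y_(n+1)],
    and let [I f (x, y)] be the function that agrees with [f] at the heights
    [y_j] and is affine in [y] on each cell.  By uniform continuity [I f] tends
    to [f] uniformly.  Written with the Green functions [k_j] of the second
    difference operator with zero boundary values, the interpolant is

      [I f (x, y) = f(x,y0) (y1 - y)/(y1 - y0) + f(x,y1) (y - y0)/(y1 - y0)
                    + sum_j q_j(x) k_j(y)],
      [q_j(x) = (2 f(x,y_j) - f(x,y_(j-1)) - f(x,y_(j+1))) / h].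

    Each [k_j] is a tent, hence nonnegative and concave; [q_j] is nonnegative
    because [f(x, .)] is concave, and it is convex because of the Monge
    condition.  The two boundary terms have convex coefficients [f(., y0)] and
    [f(., y1)]; adding a bound [C] of [|f|] to both makes them nonnegative, and
    since the two affine weights sum to [1] this is undone by the constant
    [G = - C].

    What remains is to turn the distributional Monge condition into the
    convexity of [q_j] ([curvature_convex]), that is, into a statement on mixed
    finite differences.  This is done for all pairs of stencils at once: a
    finite family of weights [w_i] and nodes [p_i] is a convex stencil when
    [sum_i w_i g(p_i) >= 0] for every convex [g], and [monge_stencil] says that
    [sum_(i,j) w_i v_j f(p_i, q_j) <= 0] for two convex stencils.  Let [K] be a
    smooth convex function whose second derivative [r] is a bump of width [e]
    at the origin ([smooth_ramp_exists]).  Then [A(x) = sum_i w_i K(x - p_i)]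
    is nonnegative, since [K(x - .)] is convex, and it vanishes away from the
    nodes, since [K] is affine on either side of the bump and stencils
    annihilate affine functions.  So [A(x) B(y)], with [B] built likewise from
    [v] and [q], is a legitimate test function; its derivative [A''(x) B''(y)]
    is the combination of the bumps [r(x - p_i) r(y - q_j)] with coefficients
    [w_i v_j], and integrating [f] against it gives, up to the modulus of
    continuity of [f], a positive multiple of [sum_(i,j) w_i v_j f(p_i, q_j)].
    Nodes on the boundary are reached by shrinking the stencils towards the
    centre of the rectangle. *)

(** * Smooth functions of one variable and a bump function *)

Definition has_derivative (R : realType) (u u' : R -> R) : Prop :=
  forall x : R, is_derive x (1 : R) u (u' x).

(** Asking for one function [u'] that is the derivative everywhere, rather than
    using [derive1], makes the closure properties below plain inductions. *)
Fixpoint nderivable (R : realType) (k : nat) (u : R -> R) : Prop :=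
  if k is k'.+1 then
    exists2 u' : R -> R, has_derivative u u' & nderivable k' u'
  else continuous u.

Definition smooth1 (R : realType) (u : R -> R) := forall k, nderivable k u.

Lemma is_derive_continuous (R : realType) (u u' : R -> R) :
  has_derivative u u' -> continuous u.
Proof.
by move=> du x; apply/differentiable_continuous/derivable1_diffP; case: (du x).
Qed.

Lemma is_derive_derive1 (R : realType) (u u' : R -> R) :
  has_derivative u u' -> derive1 u = u'.
Proof. by move=> du; apply/funext => x; rewrite derive1E (@derive_val _ _ _ _ _ _ _ (du x)). Qed.

Lemma nderivableW (R : realType) k (u : R -> R) :
  nderivable k.+1 u -> nderivable k u.
Proof.
elim: k u => [|k IH] u; first by case=> u' /is_derive_continuous.
by case=> u' du /IH u'k; exists u'.
Qed.

Lemma nderivable_cst (R : realType) k (c : R) : nderivable k (cst c).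
Proof.
elim: k c => [|k IH] c /=; first exact: cst_continuous.
by exists (cst 0) => [x|]; [exact: is_derive_cst|exact: IH].
Qed.

Lemma nderivableD (R : realType) k (u v : R -> R) :
  nderivable k u -> nderivable k v -> nderivable k (fun x => u x + v x).
Proof.
elim: k u v => [|k IH] u v.
  by move=> cu cv x; apply: continuousD; [exact: cu|exact: cv].
case=> u' du u'k [v' dv v'k]; exists (fun x => u' x + v' x); last exact: IH.
by move=> x; apply: is_deriveD.
Qed.

Lemma nderivableM (R : realType) k (u v : R -> R) :
  nderivable k u -> nderivable k v -> nderivable k (fun x => u x * v x).
Proof.
elim: k u v => [|k IH] u v.
  by move=> cu cv x; apply: continuousM; [exact: cu|exact: cv].
move=> uk vk; case: (uk) (vk) => u' du u'k [v' dv v'k].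
exists (fun x => u x * v' x + v x * u' x); last first.
  by apply: nderivableD; apply: IH => //; exact: nderivableW.
by move=> x; apply: is_deriveM.
Qed.

Lemma nderivableZ (R : realType) k (c : R) (u : R -> R) :
  nderivable k u -> nderivable k (fun x => c * u x).
Proof. by move=> uk; apply: (@nderivableM _ _ (cst c)) => //; exact: nderivable_cst. Qed.

Lemma is_derive_affine (R : realType) (a b : R) (u u' : R -> R) :
  has_derivative u u' ->
  has_derivative (fun x => u (a * x + b)) (fun x => a * u' (a * x + b)).
Proof.
move=> du x; rewrite mulrC.
have d1 : is_derive x (1:R) (fun x : R => a * x + b) a.
  have -> : (fun x : R => a * x + b) = (a \*: id) + cst b by apply/funext.
  by apply: is_derive_eq; rewrite addr0 -[LHS]/(a * 1) mulr1.
exact: (is_derive1_comp (du _) d1).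
Qed.

Lemma nderivable_affine (R : realType) k (a b : R) (u : R -> R) :
  nderivable k u -> nderivable k (fun x => u (a * x + b)).
Proof.
elim: k u => [|k IH] u /=.
  move=> cu x; apply: (@continuous_comp _ _ _ (fun x => a * x + b)); last exact: cu.
  by apply: continuousD; [apply: continuousM; [exact: cst_continuous|exact: id]|exact: cst_continuous].
case=> u' du u'k; exists (fun x => a * u' (a * x + b)).
  exact: is_derive_affine.
by apply: nderivableZ; exact: IH.
Qed.

Lemma smooth1_derive (R : realType) (u u' : R -> R) :
  has_derivative u u' -> smooth1 u -> smooth1 u'.
Proof.
by move=> du uS k; have [v dv] := uS k.+1; rewrite -(is_derive_derive1 dv) (is_derive_derive1 du).
Qed.

Lemma smooth1_antiderive (R : realType) (u u' : R -> R) :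
  has_derivative u u' -> smooth1 u' -> smooth1 u.
Proof. by move=> du uS k; apply: nderivableW; exists u'. Qed.

Lemma smooth1_id (R : realType) : smooth1 (@id R).
Proof.
apply: (@smooth1_antiderive _ _ (cst 1)) => [x|k]; last exact: nderivable_cst.
exact: is_derive_id.
Qed.

Lemma smooth1_sum (R : realType) n (u : 'I_n -> R -> R) :
  (forall i, smooth1 (u i)) -> smooth1 (fun x => \sum_(i < n) u i x).
Proof.
move=> uS k; elim: n u uS => [|n IH] u uS.
  under eq_fun do rewrite big_ord0; exact: nderivable_cst.
under eq_fun do rewrite big_ord_recl; apply: nderivableD; first exact: uS.
by apply: IH.
Qed.

(** The family [x^-n exp(-1/x)], extended by zero to [x <= 0].  It is closed
    under differentiation up to linear combinations, so that all its members can
    be shown smooth simultaneously, without describing the higher derivatives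
    of [exp(-1/x)]. *)
Definition flat (R : realType) (n : nat) (x : R) : R :=
  if 0 < x then x^-1 ^+ n * expR (- x^-1) else 0.

Lemma flat_ge0 (R : realType) n (x : R) : 0 <= flat n x.
Proof.
rewrite /flat; case: ifP => // x0.
by rewrite mulr_ge0 ?expR_ge0// exprn_ge0// invr_ge0 ltW.
Qed.

(** With [t = 1/x] this is [t^(n+2) <= (n+2)^(n+2) exp t], which follows from
    [exp t = (exp (t/(n+2)))^(n+2)] and [s <= exp s].  The quadratic bound is what
    makes every [flat n] differentiable at the origin, with derivative zero. *)
Lemma flat_le (R : realType) n (x : R) :
  flat n x <= (n.+2)%:R ^+ n.+2 * x ^+ 2.
Proof.
rewrite /flat; case: ifP => [x0|_]; last first.
  by apply: mulr_ge0; [rewrite exprn_ge0|exact: sqr_ge0].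
set t := x^-1; have t0 : 0 < t by rewrite invr_gt0.
have x0' : x != 0 by rewrite gt_eqF.
have n0 : (0 : R) < n.+2%:R by rewrite ltr0n.
have h : (t / n.+2%:R) ^+ n.+2 <= expR t.
  have tE : t = n.+2%:R * (t / n.+2%:R) by rewrite mulrC divfK// gt_eqF.
  rewrite [in leRHS]tE expRM_natl.
  apply: lerXn2r; rewrite ?nnegrE ?expR_ge0 ?divr_ge0 ?ltW//.
  by rewrite -[ltLHS]add0r (lt_le_trans _ (expR_ge1Dx _))// ltrD2r.
rewrite expRN -(@ler_pM2r _ (expR t)) ?expR_gt0// mulfVK ?gt_eqF ?expR_gt0//.
have -> : t ^+ n = n.+2%:R ^+ n.+2 * x ^+ 2 * (t / n.+2%:R) ^+ n.+2.
  have : n.+2%:R ^+ n.+2 != 0 :> R by rewrite expf_neq0 ?gt_eqF.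
  rewrite expr_div_n; move: (_%:R ^+ _) => c c0.
  by rewrite -[n.+2]addn2 exprD /t; move: (_ ^+ n) => T; field; rewrite x0' c0.
by rewrite ler_wpM2l// mulr_ge0 ?sqr_ge0// exprn_ge0.
Qed.

Lemma is_derive_flat (R : realType) n (x : R) :
  is_derive x (1 : R) (flat n) (flat n.+2 x - n%:R * flat n.+1 x).
Proof.
have [x0|x0|->] := ltgtP x 0.
- rewrite /flat ltNge ltW//= mulr0 subr0.
  apply: (@near_eq_is_derive _ _ _ (cst (0:R)) _ _ _ _ _ (is_derive_cst _ _ _)).
  near=> y; rewrite ifF//; apply/negbTE; rewrite -leNgt ltW//; near: y.
  exact: lt_nbhsl.
- have x0' : x != 0 by rewrite gt_eqF.
  have dV : is_derive x (1 : R) (fun y : R => y^-1) (- x ^- 2).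
    apply: is_derive_eq; first exact: (@is_deriveV _ id).
    exact: mulr1.
  have dE : is_derive x (1 : R) (fun y : R => expR (- y^-1)) (expR (- x^-1) * x ^- 2).
    rewrite -[x ^- 2]opprK.
    by apply: (is_derive1_comp (f := expR)).
  apply: (@near_eq_is_derive _ _ _ (fun y : R => y^-1 ^+ n * expR (- y^-1))).
    near=> y; rewrite /flat ifT//; near: y; exact: lt_nbhsr.
  have dX : is_derive x (1 : R) (fun y : R => y^-1 ^+ n) (n%:R * x^-1 ^+ n.-1 * - x ^- 2).
    have -> : (fun y : R => y^-1 ^+ n) = (fun y : R => y^-1) ^+ n.
      by apply/funext => y; elim: n => // n IH; rewrite !exprS IH.
    exact: is_deriveX.
  apply: (is_derive_eq (is_deriveM dX dE)).
  rewrite /flat x0.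
  rewrite /GRing.scale/=.
  case: n {dX} => [|n]; last by rewrite !exprS; field.
  by rewrite !expr0; field.
- rewrite /flat ltxx mulr0 subr0.
  have flat0 : flat n (0 : R) = 0 by rewrite /flat ltxx.
  have lim0 : (fun h : R => h^-1 *: ((flat n \o shift (0 : R)) (h *: (1 : R)) - flat n (0 : R))) @ 0^' --> (0 : R).
    apply/cvgrPdist_le => e e0.
    pose K : R := n.+2%:R ^+ n.+2.
    have K0 : 0 < K by rewrite exprn_gt0// ltr0n.
    near=> h.
    have h0 : h != 0 by near: h; exact: nbhs_dnbhs_neq.
    rewrite sub0r normrN /= addr0 flat0 subr0 /GRing.scale/= mulr1.
    rewrite normrM normfV ler_pdivrMl ?normr_gt0// ger0_norm ?flat_ge0//.
    apply: (le_trans (flat_le _ _)); rewrite -/K -[h ^+ 2]real_normK ?num_real//.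
    rewrite expr2 mulrCA ler_wpM2l// -ler_pdivlMl// mulrC.
    near: h. apply: dnbhs0_le; exact: divr_gt0.
  apply: DeriveDef; first by apply/cvg_ex; exists 0.
  exact: cvg_lim.
Unshelve. all: by end_near. Qed.

Lemma nderivable_flat (R : realType) k n : nderivable k (@flat R n).
Proof.
elim: k n => [|k IH] n; first exact: (is_derive_continuous (is_derive_flat n)).
exists (fun x => flat n.+2 x - n%:R * flat n.+1 x); first exact: is_derive_flat.
apply: nderivableD => //.
have := nderivableZ (- n%:R) (IH n.+1).
by congr (nderivable _ _); apply/funext => x; rewrite mulNr.
Qed.

Definition bump (R : realType) (e x : R) : R := flat 0 (x + e) * flat 0 (e - x).

Lemma smooth1_bump (R : realType) (e : R) : smooth1 (bump e).
Proof.
move=> k; apply: nderivableM.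
  have := nderivable_affine 1 e (nderivable_flat R k 0).
  by congr (nderivable _ _); apply/funext => x; rewrite mul1r.
have := nderivable_affine (-1) e (nderivable_flat R k 0).
by congr (nderivable _ _); apply/funext => x; rewrite mulN1r addrC.
Qed.

Lemma bump_ge0 (R : realType) (e x : R) : 0 <= bump e x.
Proof. by rewrite mulr_ge0 ?flat_ge0. Qed.

Lemma bump_gt0 (R : realType) (e x : R) : - e < x < e -> 0 < bump e x.
Proof.
move=> /andP[ex xe]; rewrite /bump /flat !ifT; [|lra..].
by rewrite !expr0 !mul1r mulr_gt0 ?expR_gt0.
Qed.

Lemma bump_eq0 (R : realType) (e x : R) : e <= `|x| -> bump e x = 0.
Proof.
rewrite ler_normr => /orP[h|h]; rewrite /bump /flat.
  by rewrite [X in _ * X]ifF ?mulr0//; apply/negbTE; rewrite -leNgt; lra.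
by rewrite ifF ?mul0r//; apply/negbTE; rewrite -leNgt; lra.
Qed.

(** * A smooth convex ramp *)

Lemma has_derivative_MVT (R : realType) (u u' : R -> R) (a b : R) :
  a <= b -> has_derivative u u' ->
  exists2 c, a <= c <= b & u b - u a = u' c * (b - a).
Proof.
move=> ab du; have [c + ->] := @MVT_segment _ u u' a b ab (fun x _ => du x)
  (continuous_subspaceT (is_derive_continuous du)).
by rewrite in_itv/=; exists c.
Qed.

Definition convexR (R : realType) (g : R -> R) : Prop :=
  forall a b t : R, 0 <= t <= 1 ->
  g (t * a + (1 - t) * b) <= t * g a + (1 - t) * g b.

(** The mean value theorem puts the graph above each of its tangents; averaging
    the tangent inequality at [t * a + (1 - t) * b] gives convexity. *)
Lemma convexR_derivative (R : realType) (u u' : R -> R) :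
  has_derivative u u' -> {homo u' : x y / x <= y} -> convexR u.
Proof.
move=> du u'_mono.
have tangent z y : u z + u' z * (y - z) <= u y.
  have [zy|/ltW yz] := leP z y.
    have [c /andP[zc _] e] := has_derivative_MVT zy du.
    by rewrite addrC -lerBrDr e ler_wpM2r ?subr_ge0// u'_mono.
  have [c /andP[_ cz] e] := has_derivative_MVT yz du.
  rewrite addrC -lerBrDr -[leRHS]opprB e -mulrN opprB.
  by rewrite ler_wnM2r ?subr_le0// u'_mono.
move=> a b t /andP[t0 t1]; set z := t * a + _.
have ha := ler_wpM2l t0 (tangent z a).
have hb : (1 - t) * (u z + u' z * (b - z)) <= (1 - t) * u b.
  by rewrite ler_wpM2l ?subr_ge0.
apply: (le_trans _ (lerD ha hb)); rewrite le_eqVlt; apply/orP; left; apply/eqP.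
by rewrite /z; ring.
Qed.

(** Integrating from [-oo] yields an antiderivative on the whole line at once,
    which vanishes on the left of the support. *)
Lemma antiderivative_exists (R : realType) (e : R) (u : R -> R) :
  0 < e -> continuous u -> (forall x, e <= `|x| -> u x = 0) ->
  exists2 U : R -> R, has_derivative U u & forall x, x <= - e -> U x = 0.
Proof.
move=> e0 cu u0; set mu := @lebesgue_measure R.
have iu : mu.-integrable setT (EFin \o u).
  have -> : EFin \o u = (EFin \o u) \_ `[- e, e].
    apply/funext => x; rewrite patchE; case: ifPn => //= /negP xe.
    rewrite u0// leNgt; apply/negP => xe'; apply: xe.
    by rewrite inE/= in_itv/= -ler_norml ltW.
  apply/(integrable_mkcond _ _).1 => //.
  apply: continuous_compact_integrable; first exact: segment_compact.
  exact: continuous_subspaceT.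
exists (fun x => \int[mu]_(t in `]-oo, x]) u t); last first.
  move=> x xe; rewrite /Rintegral integral0_eq// => t /=.
  by rewrite in_itv/= => tx; rewrite u0// ler_normr; apply/orP; right; lra.
move=> x; have x1 : x < x + 1 by rewrite ltrDl.
have iux : mu.-integrable [set` `]-oo, x + 1]] (EFin \o u).
  exact: integrableS iu.
have [dU dUE] := continuous_FTC1 x1 iux (ltNyr _) (cu x).
by rewrite derive1E in dUE; exact: (DeriveDef dU dUE).
Qed.

(** A ramp rounds off the corner of the function [x |-> max(0, c x)] in the
    window [[-e, e]], where all of its curvature is concentrated; the intercept
    [d] absorbs the shift of the right branch caused by the rounding. *)
Record smooth_ramp (R : realType) (e c d : R) (K K' K'' : R -> R) : Prop :=
  SmoothRamp {
    ramp_derive : has_derivative K K' ;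
    ramp_derive2 : has_derivative K' K'' ;
    ramp_smooth : smooth1 K ;
    ramp_slope_gt0 : 0 < c ;
    ramp_derive2_ge0 : forall x, 0 <= K'' x ;
    ramp_derive2_eq0 : forall x, e <= `|x| -> K'' x = 0 ;
    ramp_left : forall x, x <= - e -> K x = 0 ;
    ramp_left' : forall x, x <= - e -> K' x = 0 ;
    ramp_right : forall x, e <= x -> K x = c * x + d ;
    ramp_right' : forall x, e <= x -> K' x = c }.

(** With [U] and [S] antiderivatives of [r] and of [x r(x)], the function
    [x U(x) - S(x)] is a second antiderivative of [r].  Unlike the integral of [U]
    it involves only integrals of compactly supported functions. *)
Lemma smooth_ramp_exists (R : realType) (e : R) : 0 < e ->
  exists c d K K' K'', @smooth_ramp R e c d K K' K''.
Proof.
move=> e0.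
pose r := bump e; have r_smooth : smooth1 r := smooth1_bump e.
have r0 x : e <= `|x| -> r x = 0 by exact: bump_eq0.
have [U dU U0] := antiderivative_exists e0 (r_smooth 0%N) r0.
pose s x := x * r x.
have s_smooth : smooth1 s.
  by move=> k; apply: nderivableM; [exact: smooth1_id|exact: r_smooth].
have [S dS S0] : exists2 S : R -> R, has_derivative S s & forall x, x <= - e -> S x = 0.
  apply: (antiderivative_exists e0 (s_smooth 0%N)) => x xe.
  by rewrite /s r0// mulr0.
have cstr (V v : R -> R) : has_derivative V v ->
    (forall x, e <= `|x| -> v x = 0) -> forall x, e <= x -> V x = V e.
  move=> dV v0 x ex; have [t /andP[et _] /eqP] := has_derivative_MVT ex dV.
  by rewrite v0 ?ler_normr ?et// mul0r subr_eq0 => /eqP.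
have dK : has_derivative (fun x => x * U x - S x) U.
  move=> x; apply: is_derive_eq.
    exact: (is_deriveB (is_deriveM (is_derive_id x 1) (dU x)) (dS x)).
  by rewrite /GRing.scale/= /s mulr1 addrC addrA addNr add0r.
exists (U e), (- S e), (fun x => x * U x - S x), U, r; split => //.
- exact: smooth1_antiderive dK (smooth1_antiderive dU r_smooth).
- have [t t_in] := @MVT _ U r (- e) e ltac:(lra) (fun x _ => dU x)
    (continuous_subspaceT (is_derive_continuous dU)).
  rewrite (U0 _ (lexx _)) subr0 => ->; rewrite mulr_gt0//; last by lra.
  by apply: bump_gt0; move: t_in; rewrite in_itv.
- exact: bump_ge0.
- by move=> x xe; rewrite U0// S0// mulr0 subr0.
- move=> x ex; rewrite (cstr U r)// (cstr S s)//; first by rewrite mulrC.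
  by move=> y ye; rewrite /s r0// mulr0.
- exact: cstr.
Qed.

(** * Piecewise affine interpolation *)

Lemma compact_unif_continuous (R : realType) (T : pseudoMetricType R)
    (K : set T) (g : T -> R) : compact K -> {within K, continuous g} ->
  forall e : R, 0 < e -> exists2 d : R, 0 < d &
    forall z z', K z -> K z' -> ball z d z' -> `|g z - g z'| < e.
Proof.
move=> /compact_near_coveringP/near_covering_withinP cK cg e e0.
pose P (d : R) (z : T) := forall z', K z' -> ball z d z' -> `|g z - g z'| < e.
have : \forall d \near (0 : R)^'+, K `<=` P d.
  apply: cK => z0 Kz0.
  have /subspace_continuousP/(_ _ Kz0)/cvgrPdist_lt/(_ (e / 2)) := cg.
  rewrite divr_gt0// => /(_ isT); rewrite /= near_withinE.
  move=> /nbhs_ballP[r /= r0 rP].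
  near=> z d => Kz z' Kz' zz'.
  have z0z : ball z0 (r / 2) z.
    by near: z; apply: nbhsx_ballx; rewrite divr_gt0.
  have dr : d <= r / 2 by near: d; apply: nbhs_right_le; rewrite divr_gt0.
  have h1 : `|g z0 - g z| < e / 2.
    apply: rP => //; apply: le_ball z0z; lra.
  have h2 : `|g z0 - g z'| < e / 2.
    apply: rP => //; rewrite [r]splitr.
    by apply: ball_triangle z0z _; exact: le_ball zz'.
  rewrite -(subrKA (g z0)) (le_lt_trans (ler_normD _ _))//.
  by rewrite [e]splitr ltrD// distrC.
move=> dP; near (0 : R)^'+ => d; exists d; first by [].
by move=> z z' Kz Kz'; apply: (near dP d _ z).
Unshelve. all: by end_near. Qed.

Definition chord_slope (R : realType) (h : R) (u : nat -> R) (m : nat) : R :=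
  (u m.+1 - u m) / h.

(** A piecewise affine function is its first value, plus a linear term with the
    slope of its last piece, plus a correction at each interior node: going
    leftwards through the node [(j+1) h] the slope drops by the increment between
    the adjacent chords.  In the induction on the number of cells, adding a cell
    changes the formula only beyond the last node, and before that the last piece
    extends affinely: hence the disjunction, which lifts the upper bound on [t]
    for the last cell. *)
Lemma ramp_expansion (R : realType) (h : R) (u : nat -> R) (n m : nat) (t : R) :
  0 < h -> (m <= n)%N -> m%:R * h <= t -> t <= m.+1%:R * h \/ m = n ->
  u 0%N + chord_slope h u n * t
  - \sum_(j < n) (chord_slope h u j.+1 - chord_slope h u j)
      * Num.min t (j.+1%:R * h)
  = u m + chord_slope h u m * (t - m%:R * h).
Proof.
move=> h0; elim: n m => [|n IH] m.
  by rewrite leqn0 => /eqP-> _ _; rewrite big_ord0 mul0r !subr0.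
rewrite leq_eqVlt big_ord_recr/= => /orP[/eqP -> mt _|].
  rewrite min_r//.
  have nt : n%:R * h <= t by rewrite (le_trans _ mt)// ler_pM2r// ler_nat.
  have := IH n (leqnn _) nt (or_intror erefl).
  set S := \sum_(_ < _) _ => IHn.
  have -> : u n.+1 = u n + chord_slope h u n * h.
    by rewrite /chord_slope divfK ?gt_eqF// subrKC.
  move: IHn; rewrite -[n.+1%:R]natr1.
  set s := chord_slope h u n; set s' := chord_slope h u n.+1 => IHn.
  have -> : S = u 0%N + s * t - (u n + s * (t - n%:R * h)).
    by rewrite -IHn; ring.
  by ring.
rewrite ltnS => mn mt mt'.
have tm : t <= m.+1%:R * h.
  by case: mt' => // mE; move: mn; rewrite mE ltnn.
rewrite min_l; last by rewrite (le_trans tm)// ler_pM2r// ler_nat.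
rewrite -(IH m mn mt (or_introl tm)); ring.
Qed.

(** The Green function at the node [(j+1) h] of the second difference operator
    on [[0, (n+1) h]] with zero boundary values: a tent with its kink there. *)
Definition green (R : realType) (h : R) (n j : nat) (t : R) : R :=
  Num.min t (j.+1%:R * h) - t * (j.+1%:R / n.+1%:R).

Definition interpolant (R : realType) (h : R) (n : nat) (u : nat -> R) (t : R) : R :=
  u 0%N * (1 - t / (n.+1%:R * h)) + u n.+1 * (t / (n.+1%:R * h))
  + \sum_(j < n) (chord_slope h u j - chord_slope h u j.+1) * green h n j t.

(** Evaluating [ramp_expansion] at the right end point expresses the last slope
    by the boundary values; substituting it turns the truncations [min t ((j+1) h)]
    into Green functions. *)
Lemma interpolant_cell (R : realType) (h : R) (u : nat -> R) (n m : nat) (t : R) :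
  0 < h -> (m <= n)%N -> m%:R * h <= t <= m.+1%:R * h ->
  interpolant h n u t = u m + chord_slope h u m * (t - m%:R * h).
Proof.
move=> h0 mn /andP[mt tm].
have n0 : n.+1%:R != 0 :> R by rewrite pnatr_eq0.
rewrite -(ramp_expansion u h0 mn mt (or_introl tm)).
have nL : n%:R * h <= n.+1%:R * h by rewrite ler_pM2r// ler_nat.
have := ramp_expansion u h0 (leqnn n) nL (or_intror erefl).
have -> : u n + chord_slope h u n * (n.+1%:R * h - n%:R * h) = u n.+1.
  by rewrite -mulrBl -natr1 addrAC subrr add0r mul1r /chord_slope divfK ?gt_eqF// subrKC.
rewrite /interpolant => <-.
have -> : \sum_(j < n) (chord_slope h u j.+1 - chord_slope h u j) *
    Num.min (n.+1%:R * h) (j.+1%:R * h) =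
  (n.+1%:R * h) * \sum_(j < n) (chord_slope h u j.+1 - chord_slope h u j)
    * (j.+1%:R / n.+1%:R).
  rewrite mulr_sumr; apply: eq_bigr => j _; rewrite min_r; last first.
    by rewrite ler_pM2r// ler_nat ltnS ltnW.
  by field.
have -> : \sum_(j < n) (chord_slope h u j - chord_slope h u j.+1) * green h n j t =
   t * \sum_(j < n) (chord_slope h u j.+1 - chord_slope h u j)
    * (j.+1%:R / n.+1%:R) -
  \sum_(j < n) (chord_slope h u j.+1 - chord_slope h u j) * Num.min t (j.+1%:R * h).
  rewrite mulr_sumr -sumrB; apply: eq_bigr => j _; rewrite /green; ring.
by field; rewrite nat1r n0 gt_eqF.
Qed.

Lemma cell_exists (R : realType) (h : R) (n : nat) (t : R) :
  0 <= t <= n.+1%:R * h ->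
  exists2 m, (m <= n)%N & m%:R * h <= t <= m.+1%:R * h.
Proof.
elim: n => [|n IH] /andP[t0 tn].
  by exists 0%N; rewrite // mul0r t0.
have [tn'|/ltW nt] := leP t (n.+1%:R * h).
  have [|m mn mt] := IH; [exact/andP|exists m => //; exact: leqW].
by exists n.+1; rewrite // nt.
Qed.

(** On a cell the interpolant is a convex combination of the values at the two
    ends, both of which are within distance [h] of [t]. *)
Lemma interpolant_error (R : realType) (h : R) (u : nat -> R) (n : nat) (t v e : R) :
  0 < h -> 0 <= t <= n.+1%:R * h ->
  (forall j, (j <= n.+1)%N -> `|j%:R * h - t| <= h -> `|u j - v| <= e) ->
  `|interpolant h n u t - v| <= e.
Proof.
move=> h0 tL ue; have [m mn mt] := cell_exists tL.
rewrite (interpolant_cell u h0 mn mt).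
move: mt => /andP[mt tm].
have mh : m.+1%:R * h = m%:R * h + h by rewrite -natr1 mulrDl mul1r.
have um : `|u m - v| <= e.
  by apply: ue; rewrite ?(leqW mn)// ler_norml; apply/andP; split; lra.
have um1 : `|u m.+1 - v| <= e.
  by apply: ue; rewrite ?ltnS// ler_norml; apply/andP; split; lra.
pose a := (t - m%:R * h) / h.
have a0 : 0 <= a by rewrite divr_ge0 ?subr_ge0// ltW.
have a1 : a <= 1 by rewrite ler_pdivrMr// mul1r; lra.
have -> : u m + chord_slope h u m * (t - m%:R * h) - v =
    (1 - a) * (u m - v) + a * (u m.+1 - v).
  by rewrite /chord_slope /a; field; rewrite gt_eqF.
apply: (le_trans (ler_normD _ _)); rewrite (normrM (1 - a)) (normrM a).
rewrite (ger0_norm a0) (@ger0_norm _ (1 - a)) ?subr_ge0//.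
have -> : e = (1 - a) * e + a * e by ring.
by apply: lerD; apply: ler_wpM2l; rewrite ?subr_ge0.
Qed.

(** * Uniform approximation of continuous functions on a rectangle *)

Lemma ball2 (R : realType) (z z' : R * R) (d : R) :
  `|z.1 - z'.1| < d -> `|z.2 - z'.2| < d -> ball z d z'.
Proof. by move=> h1 h2; split; rewrite /ball/=. Qed.

Lemma rectangle_compact (R : realType) (x0 x1 y0 y1 : R) :
  compact (`[x0, x1]%classic `*` `[y0, y1]%classic).
Proof. by apply: compact_setX; exact: segment_compact. Qed.

Lemma rectangle_unif_continuous (R : realType) (x0 x1 y0 y1 : R) (f : R -> R -> R) :
  continuous_on2 (`[x0, x1]%classic `*` `[y0, y1]%classic) f ->
  forall e : R, 0 < e -> exists2 d : R, 0 < d &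
    forall x y x' y', x0 <= x <= x1 -> y0 <= y <= y1 -> x0 <= x' <= x1 ->
      y0 <= y' <= y1 -> `|x - x'| < d -> `|y - y'| < d ->
      `|f x y - f x' y'| < e.
Proof.
move=> cf e e0.
have [d d0 dP] := compact_unif_continuous (@rectangle_compact _ x0 x1 y0 y1) cf e0.
exists d => // x y x' y' hx hy hx' hy' xx' yy'.
by apply: (dP (x, y) (x', y')); [split; rewrite /= in_itv..|exact: ball2].
Qed.

Lemma interpolant_approx (R : realType) (x0 x1 y0 y1 : R) (f : R -> R -> R) :
  y0 < y1 -> continuous_on2 (`[x0, x1]%classic `*` `[y0, y1]%classic) f ->
  forall e : R, 0 < e -> \forall n \near \oo,
  let h := (y1 - y0) / n.+1%:R in
  forall x y, x0 <= x <= x1 -> y0 <= y <= y1 ->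
    `|interpolant h n (fun j => f x (y0 + j%:R * h)) (y - y0) - f x y| <= e.
Proof.
move=> y01 cf e e0; have [d d0 dP] := rectangle_unif_continuous cf e0.
have L0 : 0 < y1 - y0 by rewrite subr_gt0.
near=> n => /=; set h := _ / _; move=> x y hx /andP[y0y yy1].
have n0 : 0 < n.+1%:R :> R by rewrite ltr0n.
have h0 : 0 < h by rewrite divr_gt0.
have hn : n.+1%:R * h = y1 - y0 by rewrite mulrC divfK// gt_eqF.
have hd : h < d.
  rewrite /h ltr_pdivrMr// mulrC -ltr_pdivrMr//.
  apply: (@lt_le_trans _ _ n%:R); last by rewrite ler_nat.
  near: n; exact: nbhs_infty_gtr.
apply: interpolant_error => //; first by rewrite hn subr_ge0 y0y lerD2r.
move=> j jn jt; apply/ltW/dP => //; rewrite ?subrr ?normr0//.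
- rewrite lerDl mulr_ge0 ?(ltW h0)//= addrC -lerBrDr -hn ler_pM2r//.
  by rewrite ler_nat.
- exact/andP.
- apply: le_lt_trans hd; apply: le_trans jt; rewrite le_eqVlt; apply/orP; left.
  by apply/eqP; congr (`| _ |); ring.
Unshelve. all: by end_near. Qed.

Lemma continuous_on2_slice (R : realType) (X Y : set R) (f : R -> R -> R) (y : R) :
  continuous_on2 (X `*` Y) f -> Y y -> {within X, continuous (f ^~ y)}.
Proof.
move=> cf Yy; apply/subspace_continuousP => x Xx.
have /subspace_continuousP/(_ (x, y) (conj Xx Yy)) := cf.
move=> /cvgrPdist_lt h; apply/cvgrPdist_lt => e e0.
have := h e e0; rewrite /= !near_withinE => /nbhs_ballP[r /= r0 rP].
apply/nbhs_ballP; exists r => // x' xx' Xx'.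
by apply: (rP (x', y)) => //; split => //=; exact: ballxx.
Qed.

(** Measurability for the product sigma-algebra is inherited from the one-variable
    factors of the interpolants, which converge to [f]. *)
Lemma measurable_continuous_on2 (R : realType) (x0 x1 y0 y1 : R) (f : R -> R -> R) :
  y0 < y1 -> continuous_on2 (`[x0, x1]%classic `*` `[y0, y1]%classic) f ->
  measurable_fun (`[x0, x1]%classic `*` `[y0, y1]%classic)
    (fun z : measurableTypeR R * measurableTypeR R => f z.1 z.2).
Proof.
move=> y01 cf; set D := (_ `*` _).
have mD : measurable D by apply: measurableX; exact: measurable_itv.
pose h n : R := (y1 - y0) / n.+1%:R.
pose F n (z : measurableTypeR R * measurableTypeR R) :=
  interpolant (h n) n (fun j => f z.1 (y0 + j%:R * h n)) (z.2 - y0).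
have mslice n j : (j <= n.+1)%N -> measurable_fun D
    (fun z : measurableTypeR R * measurableTypeR R => f z.1 (y0 + j%:R * h n)).
  move=> jn; pose g x := f x (y0 + j%:R * h n).
  apply: (@measurable_comp _ _ _ _ _ _ `[x0, x1]%classic g D fst) => //.
  - by move=> _ [z [zX _] <-].
  - apply: subspace_continuous_measurable_fun => //.
    apply: continuous_on2_slice cf _.
    rewrite /= in_itv/= lerDl mulr_ge0 ?divr_ge0 ?subr_ge0 ?(ltW y01)//=.
    rewrite addrC -lerBrDr /h mulrCA -[leRHS]mulr1 ler_wpM2l ?subr_ge0 ?(ltW y01)//.
    by rewrite ler_pdivrMr ?ltr0n// mul1r ler_nat.
  - by apply: measurable_funTS.
have msnd : measurable_fun D
    (fun z : measurableTypeR R * measurableTypeR R => z.2 - y0).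
  by apply: measurable_funB => //; apply: measurable_funTS.
apply: (@measurable_fun_cvg _ _ _ D F).
  move=> n; rewrite /F /interpolant.
  apply: measurable_funD; [apply: measurable_funD|].
  - apply: measurable_funM; first exact: mslice.
    by apply: measurable_funB => //; apply: measurable_funM.
  - by apply: measurable_funM; [exact: mslice|exact: measurable_funM].
  - apply: measurable_sum => j; apply: measurable_funM.
      rewrite /chord_slope; apply: measurable_funB; apply: measurable_funM => //;
        by apply: measurable_funB; apply: mslice;
           rewrite ?ltnS ?ltn_ord// ltnW ?ltn_ord// leqW// ltn_ord.
    rewrite /green; apply: measurable_funB; last exact: measurable_funM.
    exact: measurable_minr.
move=> [x y] [/= xX yY]; apply/cvgrPdist_le => e e0.
near=> n; rewrite distrC.
move: xX yY; rewrite !in_itv/= => xX yY.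
by move: x y xX yY; near: n; exact: interpolant_approx cf _ e0.
Unshelve. all: by end_near. Qed.

(** * Integration against translated bumps *)

Lemma continuous_translate (R : realType) (p : R) (u : R -> R) :
  continuous u -> continuous (fun x => u (x - p)).
Proof.
move=> cu x; apply: (@continuous_comp _ _ _ (fun x => x - p)); last exact: cu.
by apply: continuousB; [exact: id|exact: cst_continuous].
Qed.

Lemma has_derivative_shift (R : realType) (p : R) (u u' : R -> R) :
  has_derivative u u' -> has_derivative (fun x => u (x - p)) (fun x => u' (x - p)).
Proof.
move=> du x; have := is_derive_affine 1 (- p) du x.
rewrite !mul1r; have -> // : (fun x : R => u (1 * x - p)) = (fun x => u (x - p)).
by apply/funext => y; rewrite mul1r.
Qed.

(** The slope [K'] rises from [0] to [c] across the bump, wherever the bump sits. *)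
Lemma ramp_mass (R : realType) (e c d x0 x1 p : R) (K K' r : R -> R) :
  smooth_ramp e c d K K' r -> continuous r -> 0 < e -> x0 + e <= p <= x1 - e ->
  (\int[@lebesgue_measure R]_(x in `[x0, x1]) (r (x - p))%:E)%E = c%:E.
Proof.
move=> rK cr e0 /andP[h0 h1]; have dF := has_derivative_shift p (ramp_derive2 rK).
have cF : continuous (fun x => K' (x - p)) by exact: is_derive_continuous dF.
have cr' : continuous (fun x => r (x - p)).
  exact: continuous_translate.
rewrite (@continuous_FTC2 _ (fun x => r (x - p)) (fun x => K' (x - p)) x0 x1).
- by rewrite (ramp_right' rK) ?(ramp_left' rK) ?sube0//; lra.
- lra.
- exact: continuous_subspaceT.
- split=> [x _||].
  + by case: (dF x).
  + exact/cvg_at_right_filter/cF.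
  + exact/cvg_at_left_filter/cF.
- by move=> x _; rewrite (is_derive_derive1 dF).
Qed.

Lemma integral_tensor (R : realType) (X Y : set (measurableTypeR R))
    (a b : measurableTypeR R -> R) :
  measurable X -> measurable Y -> measurable_fun X a -> measurable_fun Y b ->
  (forall x, 0 <= a x) -> (forall y, 0 <= b y) ->
  (\int[@lebesgue_measure R \x @lebesgue_measure R]_(z in X `*` Y)
     (a z.1 * b z.2)%:E =
   \int[@lebesgue_measure R]_(x in X) (a x)%:E *
   \int[@lebesgue_measure R]_(y in Y) (b y)%:E)%E.
Proof.
move=> mX mY ma mb a0 b0; set mu := @lebesgue_measure R.
pose a' := a \_ X; pose b' := b \_ Y.
have a'0 x : 0 <= a' x by rewrite /a' patchE; case: ifP => /= _; rewrite ?lexx ?a0.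
have b'0 y : 0 <= b' y by rewrite /b' patchE; case: ifP => /= _; rewrite ?lexx ?b0.
have ma' : measurable_fun setT a' by have [h _] := measurable_restrictT a mX; exact: h.
have mb' : measurable_fun setT b' by have [h _] := measurable_restrictT b mY; exact: h.
have aE : (\int[mu]_(x in X) (a x)%:E = \int[mu]_x (a' x)%:E)%E.
  by rewrite integral_mkcond; apply: eq_integral => x _; rewrite /a' /b' !patchE; case: ifP.
have bE : (\int[mu]_(x in Y) (b x)%:E = \int[mu]_x (b' x)%:E)%E.
  by rewrite integral_mkcond; apply: eq_integral => x _; rewrite /a' /b' !patchE; case: ifP.
rewrite aE bE integral_mkcond.
rewrite (_ : (fun z => (a z.1 * b z.2)%:E) \_ (X `*` Y) =
    (fun z : measurableTypeR R * measurableTypeR R => (a' z.1 * b' z.2)%:E)).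
  rewrite fubini_tonelli1; last 2 first.
  - apply/measurable_EFinP; apply: measurable_funM.
      exact: measurableT_comp.
    exact: measurableT_comp.
  - by move=> z; rewrite lee_fin mulr_ge0.
  rewrite /fubini_F /=.
  under eq_integral => x _.
    under eq_integral do rewrite EFinM.
    rewrite ge0_integralZl//; last 3 first.
    - exact/measurable_EFinP.
    - by move=> y _; rewrite lee_fin.
    - by rewrite lee_fin.
    over.
  rewrite ge0_integralZr//.
  - exact/measurable_EFinP.
  - by move=> x _; rewrite lee_fin.
  - by apply: integral_ge0 => y _; rewrite lee_fin.
apply/funext => -[x y]; rewrite /a' /b' !patchE in_setX/=.
by case: (x \in X); case: (y \in Y) => /=; rewrite ?mulr0 ?mul0r.
Qed.

Lemma integrable_continuous_on2 (R : realType) (x0 x1 y0 y1 : R) (f : R -> R -> R) :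
  y0 < y1 -> continuous_on2 (`[x0, x1]%classic `*` `[y0, y1]%classic) f ->
  (@lebesgue_measure R \x @lebesgue_measure R)%E.-integrable
    (`[x0, x1]%classic `*` `[y0, y1]%classic) (fun z => (f z.1 z.2)%:E).
Proof.
move=> y01 cf.
apply: measurable_bounded_integrable.
- by apply: measurableX; exact: measurable_itv.
- have mitv a b : measurable (`[a, b]%classic : set (measurableTypeR R)).
    exact: measurable_itv.
  apply: (eq_ind_r (fun v => (v < +oo)%E) _
    (product_measure1E lebesgue_measure lebesgue_measure (mitv x0 x1) (mitv y0 y1))).
  have fin a b : (@lebesgue_measure R `[a, b]%classic) \is a fin_num.
    by rewrite lebesgue_measure_itv/=; case: ifP.
  apply: lte_mul_pinfty; [exact: measure_ge0|exact: fin|].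
  by have := fin y0 y1; rewrite ge0_fin_numE ?measure_ge0.
- exact: measurable_continuous_on2.
- have := compact_bounded (continuous_compact cf (@rectangle_compact _ x0 x1 y0 y1)).
  move=> [M [Mr MP]]; exists M; split => // N MN z Dz.
  by apply: MP MN _ _; exists z.
Qed.

(** Averaging [g] against a nonnegative kernel changes it by at most its
    oscillation over the support of the kernel. *)
Lemma kernel_average (d : measure_display) (T : measurableType d) (R : realType)
    (mu : {measure set T -> \bar R}) (D : set T) (g k : T -> R) (v delta : R) :
  measurable D -> mu.-integrable D (EFin \o k) ->
  mu.-integrable D (EFin \o (fun z => g z * k z)) ->
  (forall z, D z -> 0 <= k z) ->
  (forall z, D z -> k z != 0 -> `|g z - v| <= delta) ->
  `|\int[mu]_(z in D) (g z * k z) - v * \int[mu]_(z in D) k z|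
    <= delta * \int[mu]_(z in D) k z.
Proof.
move=> mD ik igk k0 gv.
have bnd z : D z -> (v - delta) * k z <= g z * k z <= (v + delta) * k z.
  move=> Dz; have [->|kz] := eqVneq (k z) 0; first by rewrite !mulr0 lexx.
  have := gv z Dz kz; rewrite ler_distl => /andP[h1 h2].
  by rewrite !ler_wpM2r ?k0.
have iZ a : mu.-integrable D (EFin \o (fun z => a * k z)).
  have := integrableZl mD a ik; congr (mu.-integrable D _).
have lo : \int[mu]_(z in D) ((v - delta) * k z) <= \int[mu]_(z in D) (g z * k z).
  by apply: le_Rintegral => // z /bnd/andP[].
have hi : \int[mu]_(z in D) (g z * k z) <= \int[mu]_(z in D) ((v + delta) * k z).
  by apply: le_Rintegral => // z /bnd/andP[].
rewrite RintegralZl// mulrBl in lo; rewrite RintegralZl// mulrDl in hi.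
rewrite ler_norml; apply/andP; split; lra.
Qed.

Lemma Rintegral_sum (d : measure_display) (T : measurableType d) (R : realType)
    (mu : {measure set T -> \bar R}) (D : set T) n (g : 'I_n -> T -> R) :
  measurable D -> (forall i, mu.-integrable D (EFin \o g i)) ->
  \int[mu]_(z in D) (\sum_(i < n) g i z) = \sum_(i < n) \int[mu]_(z in D) g i z.
Proof.
move=> mD ig; rewrite /Rintegral.
under eq_integral do rewrite -sumEFin.
rewrite integral_sum// -sum_fine// => i _.
by apply: integrable_fin_num => //; exact: ig.
Qed.

(** * Convex stencils and the test functions they define *)

(** Equivalently, the signed measure [sum_i w_i delta_(p_i)] is nonnegative in
    the convex order. *)
Definition convex_stencil (R : realType) n (w p : 'I_n -> R) : Prop :=
  forall g : R -> R, convexR g -> 0 <= \sum_(i < n) w i * g (p i).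

Lemma convexR_affine (R : realType) (a b : R) (g : R -> R) :
  convexR g -> convexR (fun x => g (a * x + b)).
Proof.
move=> cg x y t t01; have := cg (a * x + b) (a * y + b) t t01.
by congr (g _ <= _); ring.
Qed.

Lemma stencil_scale (R : realType) n (w p : 'I_n -> R) (a b : R) :
  convex_stencil w p -> convex_stencil w (fun i => a * p i + b).
Proof. by move=> wp g cg; apply: wp (fun x => g (a * x + b)) _; exact: convexR_affine. Qed.

(** Affine functions are convex together with their opposites. *)
Lemma stencil_affine (R : realType) n (w p : 'I_n -> R) (a b : R) :
  convex_stencil w p -> \sum_(i < n) w i * (a * p i + b) = 0.
Proof.
move=> wp; apply/eqP; rewrite eq_le; apply/andP; split; last first.
  by apply: (wp (fun x => a * x + b)) => x y t _; rewrite le_eqVlt; apply/orP; left; apply/eqP; ring.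
rewrite -oppr_ge0 -sumrN.
have : 0 <= \sum_(i < n) w i * (- (a * p i + b)).
  by apply: (wp (fun x => - (a * x + b))) => x y t _; rewrite le_eqVlt; apply/orP; left; apply/eqP; ring.
by under eq_bigr do rewrite mulrN.
Qed.

(** The weights and nodes of the Jensen defect
    [t g(a) + (1 - t) g(b) - g(t a + (1 - t) b)]; [t = 1/2] gives the symmetric
    second difference. *)
Definition jensen_weight (R : realType) (t : R) (i : 'I_3) : R :=
  nth 0 [:: t; 1 - t; -1] i.

Definition jensen_node (R : realType) (t a b : R) (i : 'I_3) : R :=
  nth 0 [:: a; b; t * a + (1 - t) * b] i.

Lemma jensen_sum (R : realType) (t a b : R) (g : R -> R) :
  \sum_(i < 3) jensen_weight t i * g (jensen_node t a b i) =
  t * g a + (1 - t) * g b - g (t * a + (1 - t) * b).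
Proof.
by rewrite 3!big_ord_recl big_ord0 /jensen_weight /jensen_node /= mulN1r addr0 addrA.
Qed.

Lemma jensen_stencil (R : realType) (t a b : R) : 0 <= t <= 1 ->
  convex_stencil (jensen_weight t) (jensen_node t a b).
Proof. by move=> t01 g cg; rewrite jensen_sum subr_ge0 cg. Qed.

Lemma has_derivativeZ (R : realType) (a : R) (u u' : R -> R) :
  has_derivative u u' -> has_derivative (fun x => a * u x) (fun x => a * u' x).
Proof. by move=> du x; exact: (is_deriveZ a (du x)). Qed.

Lemma has_derivative_sum (R : realType) n (u u' : 'I_n -> R -> R) :
  (forall i, has_derivative (u i) (u' i)) ->
  has_derivative (fun x => \sum_(i < n) u i x) (fun x => \sum_(i < n) u' i x).
Proof.
elim: n u u' => [|n IH] u u' du x.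
  under eq_fun do rewrite big_ord0; rewrite big_ord0; exact: is_derive_cst.
under eq_fun do rewrite big_ord_recl; rewrite big_ord_recl.
exact: is_deriveD (du ord0 x) (IH _ _ (fun i => du (lift ord0 i)) x).
Qed.

(** For a ramp [K] this is a second antiderivative of the stencil mollified by
    the bump [K'']; it is nonnegative because [K] is convex, and has compact
    support because stencils annihilate affine functions. *)
Definition smear (R : realType) n (w p : 'I_n -> R) (K : R -> R) (x : R) : R :=
  \sum_(i < n) w i * K (x - p i).

Lemma smear_derivative (R : realType) n (w p : 'I_n -> R) (K K' : R -> R) :
  has_derivative K K' -> has_derivative (smear w p K) (smear w p K').
Proof.
move=> dK; apply: (@has_derivative_sum _ n (fun i x => w i * K (x - p i))
  (fun i x => w i * K' (x - p i))) => i; apply: has_derivativeZ.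
exact: has_derivative_shift.
Qed.

Lemma smear_smooth (R : realType) n (w p : 'I_n -> R) (K : R -> R) :
  smooth1 K -> smooth1 (smear w p K).
Proof.
move=> sK; apply: (@smooth1_sum _ n (fun i x => w i * K (x - p i))) => i k.
apply: nderivableZ.
have := nderivable_affine 1 (- p i) (sK k).
by congr nderivable; apply/funext => x; rewrite mul1r.
Qed.

Lemma ramp_convex (R : realType) (e c d : R) (K K' r : R -> R) :
  smooth_ramp e c d K K' r -> convexR K.
Proof.
move=> rK; apply: (convexR_derivative (ramp_derive rK)) => x y xy.
have [z _ /eqP] := has_derivative_MVT xy (ramp_derive2 rK).
rewrite subr_eq => /eqP ->; rewrite lerDr mulr_ge0 ?subr_ge0//.
exact: ramp_derive2_ge0 rK _.
Qed.

Lemma smear_ge0 (R : realType) n (w p : 'I_n -> R) (e c d : R) (K K' r : R -> R) (x : R) :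
  smooth_ramp e c d K K' r -> convex_stencil w p -> 0 <= smear w p K x.
Proof.
move=> rK wp; have := wp _ (convexR_affine (-1) x (ramp_convex rK)).
by under eq_bigr do rewrite mulN1r addrC.
Qed.

(** To the left of all bumps every [K (x - p i)] vanishes; to their right each
    of them is affine in [p i]. *)
Lemma smear_eq0 (R : realType) n (w p : 'I_n -> R) (e c d a b : R)
    (K K' r : R -> R) (x : R) :
  smooth_ramp e c d K K' r -> convex_stencil w p ->
  (forall i, a + e <= p i <= b - e) -> x <= a \/ b <= x -> smear w p K x = 0.
Proof.
move=> rK wp pab [xa|bx].
  apply: big1 => i _; have /andP[h _] := pab i.
  by rewrite (ramp_left rK) ?mulr0//; lra.
rewrite -(stencil_affine (- c) (c * x + d) wp); apply: eq_bigr => i _.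
have /andP[_ h] := pab i; rewrite (ramp_right rK); last by lra.
by congr (_ * _); ring.
Qed.

Definition tensor (R : realType) (A B : R -> R) : R -> R -> R := fun x y => A x * B y.

Lemma has_derivativeZr (R : realType) (a : R) (u u' : R -> R) :
  has_derivative u u' -> has_derivative (fun x => u x * a) (fun x => u' x * a).
Proof.
move=> /(has_derivativeZ a) du x; have := du x.
by rewrite mulrC; have -> : (fun x => a * u x) = (fun x => u x * a)
  by apply/funext => y; rewrite mulrC.
Qed.

Lemma dx_tensor (R : realType) (A A' B : R -> R) :
  has_derivative A A' -> dx (tensor A B) = tensor A' B.
Proof.
move=> dA; apply/funext => x; apply/funext => y.
by rewrite /dx (is_derive_derive1 (has_derivativeZr (B y) dA)).
Qed.

Lemma dy_tensor (R : realType) (A B B' : R -> R) :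
  has_derivative B B' -> dy (tensor A B) = tensor A B'.
Proof.
move=> dB; apply/funext => x; apply/funext => y.
by rewrite /dy (is_derive_derive1 (has_derivativeZ (A x) dB)).
Qed.

Lemma tensor_continuous (R : realType) (A B : R -> R) :
  continuous A -> continuous B ->
  continuous (fun z : R * R => tensor A B z.1 z.2).
Proof.
move=> cA cB z; apply: continuousM.
  by apply: (@continuous_comp _ _ _ fst); [exact: cvg_fst|exact: cA].
by apply: (@continuous_comp _ _ _ snd); [exact: cvg_snd|exact: cB].
Qed.

Lemma tensor_smooth (R : realType) (A B : R -> R) :
  smooth1 A -> smooth1 B -> smooth (tensor A B).
Proof.
move=> sA sB k; elim: k A B sA sB => [|k IH] A B sA sB.
  by split=> //; exact: tensor_continuous (sA 0%N) (sB 0%N).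
have [A' dA _] := sA 1%N; have [B' dB _] := sB 1%N.
split; first exact: tensor_continuous (sA 0%N) (sB 0%N).
split.
- by move=> x y; case: (has_derivativeZr (B y) dA x).
- by move=> x y; case: (has_derivativeZ (A x) dB y).
- by rewrite (dx_tensor B dA); apply: IH => //; exact: smooth1_derive dA sA.
- by rewrite (dy_tensor A dB); apply: IH => //; exact: smooth1_derive dB sB.
Qed.

Lemma tensor_test_function (R : realType) (x0 x1 y0 y1 a b a' b' : R) (A B : R -> R) :
  smooth1 A -> smooth1 B -> (forall x, 0 <= A x) -> (forall y, 0 <= B y) ->
  x0 < a -> b < x1 -> y0 < a' -> b' < y1 ->
  (forall x, x <= a \/ b <= x -> A x = 0) ->
  (forall y, y <= a' \/ b' <= y -> B y = 0) ->
  nonneg_test_function (`[x0, x1]%classic `*` `[y0, y1]%classic) (tensor A B).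
Proof.
move=> sA sB A0 B0 xa bx ya by' sa sb.
have supp : tsupport (tensor A B) `<=` `[a, b]%classic `*` `[a', b']%classic.
  have cl : closed (`[a, b]%classic `*` `[a', b']%classic : set (R * R)).
    apply: compact_closed; first exact: norm_hausdorff.
    exact: rectangle_compact.
  rewrite /tsupport closureE => z; apply; split => //.
  move=> [x y] /=; rewrite /tensor mulf_eq0 negb_or => /andP[Ax By].
  split; rewrite /= in_itv/=.
    have [xa'|ax] := leP x a; first by move: Ax; rewrite sa ?eqxx//; left.
    have [bx'|xb] := leP b x; first by move: Ax; rewrite sa ?eqxx//; right.
    by rewrite !ltW.
  have [xa'|ax] := leP y a'; first by move: By; rewrite sb ?eqxx//; left.
  have [bx'|xb] := leP b' y; first by move: By; rewrite sb ?eqxx//; right.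
  by rewrite !ltW.
split.
- exact: tensor_smooth.
- apply: subclosed_compact supp; first exact: closed_closure.
  exact: rectangle_compact.
- move=> [x y] /supp [/=]; rewrite !in_itv/= => /andP[ax xb] /andP[ay yb].
  exists (`]x0, x1[%classic, `]y0, y1[%classic) => /=.
    split; apply: open_nbhs_nbhs; split; try exact: interval_open.
      by rewrite /= in_itv/=; apply/andP; split; lra.
    by rewrite /= in_itv/=; apply/andP; split; lra.
  by move=> z [/= zx zy]; split; apply: subset_itv_oo_cc.
- by move=> x y; rewrite mulr_ge0.
Qed.

(** * The Monge condition for finite differences *)

(** The conclusion is closed in the matrix [F], so it may be checked on
    arbitrarily good approximations. *)
Lemma stencil_sum_limit (R : realType) n m (w : 'I_n -> R) (v : 'I_m -> R)
    (F : 'I_n -> 'I_m -> R) :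
  (forall delta : R, 0 < delta -> exists2 F' : 'I_n -> 'I_m -> R,
      forall i j, `|F i j - F' i j| <= delta &
      \sum_(i < n) \sum_(j < m) w i * v j * F' i j <= 0) ->
  \sum_(i < n) \sum_(j < m) w i * v j * F i j <= 0.
Proof.
move=> approx; pose W := \sum_(i < n) \sum_(j < m) `|w i * v j|.
have W0 : 0 <= W by apply: sumr_ge0 => i _; apply: sumr_ge0.
apply/ler_addgt0Pr => eta eta0; rewrite add0r.
have W1 : 0 < W + 1 by lra.
have delta0 : 0 < eta / (W + 1) by rewrite divr_gt0.
have [F' FF' F'0] := approx _ delta0.
apply: (@le_trans _ _ (\sum_(i < n) \sum_(j < m) w i * v j * F' i j + W * (eta / (W + 1)))).
  rewrite -lerBlDl -sumrB mulr_suml; apply: ler_sum => i _.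
  rewrite -sumrB mulr_suml; apply: ler_sum => j _.
  by rewrite -mulrBr (le_trans (ler_norm _))// normrM ler_wpM2l.
have : W * (eta / (W + 1)) <= eta.
  by rewrite mulrCA ger_pMr// ler_pdivrMr// mul1r; lra.
by move: F'0; lra.
Qed.

(** The approximations [T i j / (c * c)] of [f (p i) (q j)] are the averages of
    [f] against the product of the bumps at [p i] and [q j].  The combination of
    the [T i j] is the integral of [f] against the mixed fourth derivative of the
    test function [smear w p K (x) * smear v q K (y)], so the Monge condition gives
    its sign. *)
Lemma monge_stencil_interior (R : realType) (x0 x1 y0 y1 : R) (f : R -> R -> R)
    n m (w p : 'I_n -> R) (v q : 'I_m -> R) :
  x0 < x1 -> y0 < y1 ->
  continuous_on2 (`[x0, x1]%classic `*` `[y0, y1]%classic) f ->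
  mixed_monge (`[x0, x1]%classic `*` `[y0, y1]%classic) f ->
  convex_stencil w p -> convex_stencil v q ->
  (forall i, x0 < p i < x1) -> (forall j, y0 < q j < y1) ->
  \sum_(i < n) \sum_(j < m) w i * v j * f (p i) (q j) <= 0.
Proof.
move=> x01 y01 cf monge wp vq px qy.
apply: (@stencil_sum_limit _ _ _ w v (fun i j => f (p i) (q j))) => delta delta0.
have [d d0 dP] := rectangle_unif_continuous cf delta0.
have [e [e0 ed pe qe]] : exists e : R, [/\ 0 < e, e < d,
    forall i, x0 + e + e <= p i <= x1 - e - e &
    forall j, y0 + e + e <= q j <= y1 - e - e].
  (* The margin is 2e: the bumps must stay at distance e from the boundary for
     the support of the test function to lie in the interior. *)
  have margin (a b c : R) : a < c < b -> \forall e \near (0 : R)^'+, a + e + e <= c <= b - e - e.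
    move=> /andP[ac cb]; near=> e.
    have h1 : e <= (c - a) / 2 by near: e; apply: nbhs_right_le; lra.
    have h2 : e <= (b - c) / 2 by near: e; apply: nbhs_right_le; lra.
    by apply/andP; split; lra.
  near (0 : R)^'+ => e; exists e; split.
  - by [].
  - near: e; exact: nbhs_right_lt.
  - near: e; apply: filter_forall => i; exact: margin.
  - near: e; apply: filter_forall => j; exact: margin.
have [c [k [K [K' [r rK]]]]] := smooth_ramp_exists e0.
have cr : continuous r.
  have := smooth1_derive (ramp_derive2 rK)
    (smooth1_derive (ramp_derive rK) (ramp_smooth rK)).
  by move=> /(_ 0%N).
have c0 := ramp_slope_gt0 rK.
set D := `[x0, x1]%classic `*` `[y0, y1]%classic in cf monge.
set mu := (@lebesgue_measure R \x @lebesgue_measure R)%E.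
pose ker i j (z : R * R) := r (z.1 - p i) * r (z.2 - q j).
have mD : measurable (D : set (measurableTypeR R * measurableTypeR R)).
  by apply: measurableX; exact: measurable_itv.
have crs a : continuous (fun x => r (x - a)) by exact: continuous_translate.
have cker i j : continuous (ker i j).
  exact: (tensor_continuous (crs (p i)) (crs (q j))).
have iker i j : mu.-integrable D (EFin \o ker i j).
  apply: (integrable_continuous_on2 (f := fun x y => ker i j (x, y))) => //.
  apply: continuous_subspaceT => z; exact: cker.
have ifker i j : mu.-integrable D (EFin \o (fun z => f z.1 z.2 * ker i j z)).
  apply: (integrable_continuous_on2 (f := fun x y => f x y * ker i j (x, y))) => //.
  apply/subspace_continuousP => z Dz; apply: cvgM.
    by move/subspace_continuousP : cf; exact.
  by move: z Dz; apply/subspace_continuousP/continuous_subspaceT => -[x y]; exact: cker.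
have mass i j : \int[mu]_(z in D) ker i j z = c * c.
  rewrite /Rintegral /ker /mu /D.
  have mr a (X : set (measurableTypeR R)) : measurable_fun X (fun x => r (x - a)).
    by apply: measurable_funTS; exact: continuous_measurable_fun.
  rewrite (integral_tensor (a := fun x => r (x - p i)) (b := fun y => r (y - q j)))//.
  - rewrite (ramp_mass rK cr e0) ?(ramp_mass rK cr e0)//.
      by have := qe j; lra.
    by have := pe i; lra.
  - by move=> x; exact: ramp_derive2_ge0 rK _.
  - by move=> x; exact: ramp_derive2_ge0 rK _.
pose T i j := \int[mu]_(z in D) (f z.1 z.2 * ker i j z).
exists (fun i j => T i j / (c * c)).
  move=> i j; have cc : 0 < c * c by rewrite mulr_gt0.
  rewrite -(ler_pM2r cc) -[X in _ * X <= _](gtr0_norm cc) -normrM.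
  rewrite mulrBl divfK ?gt_eqF// distrC.
  rewrite -(mass i j).
  apply: (@kernel_average _ _ _ mu D (fun z => f z.1 z.2) (ker i j)) => //.
  - by move=> z _; rewrite mulr_ge0 ?(ramp_derive2_ge0 rK).
  - move=> [x y] [/=]; rewrite !in_itv/= /ker/= => xX yY.
    rewrite mulf_eq0 negb_or => /andP[rx ry].
    have xe : `|x - p i| < e.
      by rewrite ltNge; apply: contra rx => h; rewrite (ramp_derive2_eq0 rK).
    have ye : `|y - q j| < e.
      by rewrite ltNge; apply: contra ry => h; rewrite (ramp_derive2_eq0 rK).
    apply/ltW/dP => //.
    + by have := px i; move=> /andP[h1 h2]; rewrite !ltW.
    + by have := qy j; move=> /andP[h1 h2]; rewrite !ltW.
    + exact: lt_trans ed.
    + exact: lt_trans ed.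
have sK1 : smooth1 K := ramp_smooth rK.
have test : nonneg_test_function D (tensor (smear w p K) (smear v q K)).
  apply: (@tensor_test_function _ x0 x1 y0 y1 (x0 + e) (x1 - e) (y0 + e) (y1 - e));
    try exact: smear_smooth; try lra.
  - by move=> x; exact: smear_ge0 rK wp.
  - by move=> x; exact: smear_ge0 rK vq.
  - by move=> x; exact: smear_eq0 rK wp pe.
  - by move=> x; exact: smear_eq0 rK vq qe.
have := monge _ test.
have dA := smear_derivative w p (ramp_derive rK).
have dA' := smear_derivative w p (ramp_derive2 rK).
have dB := smear_derivative v q (ramp_derive rK).
have dB' := smear_derivative v q (ramp_derive2 rK).
rewrite (dy_tensor _ dB) (dy_tensor _ dB') (dx_tensor _ dA) (dx_tensor _ dA').
rewrite oppr_ge0 -/mu.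
have -> : \int[mu]_(z in D) (f z.1 z.2 * tensor (smear w p r) (smear v q r) z.1 z.2) =
    \sum_(i < n) \sum_(j < m) w i * v j * T i j.
  have iwv i j : mu.-integrable D (EFin \o (fun z => w i * v j * (f z.1 z.2 * ker i j z))).
    by have := integrableZl mD (w i * v j) (ifker i j); congr (mu.-integrable D _).
  transitivity (\int[mu]_(z in D) (\sum_(i < n) \sum_(j < m) w i * v j * (f z.1 z.2 * ker i j z))).
    apply: eq_Rintegral => z _; rewrite /tensor /smear mulr_suml mulr_sumr.
    apply: eq_bigr => i _; rewrite mulr_sumr mulr_sumr; apply: eq_bigr => j _.
    by rewrite /ker; ring.
  rewrite Rintegral_sum//.
    apply: eq_bigr => i _; rewrite Rintegral_sum//.
    by apply: eq_bigr => j _; rewrite RintegralZl.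
  move=> i.
  have := integrable_sum mD (index_enum 'I_m) (P := xpredT) (fun j _ => iwv i j).
  by congr (mu.-integrable D _); apply/funext => z /=; rewrite sumEFin.
move=> h; under eq_bigr do under eq_bigr do rewrite mulrA.
under eq_bigr do rewrite -mulr_suml.
rewrite -mulr_suml mulr_le0_ge0//.
by rewrite invr_ge0 mulr_ge0// ltW.
Unshelve. all: by end_near. Qed.

(** Contracting the rectangle slightly towards its centre moves the nodes into
    the interior, and affine maps send stencils to stencils. *)
Lemma monge_stencil (R : realType) (x0 x1 y0 y1 : R) (f : R -> R -> R)
    n m (w p : 'I_n -> R) (v q : 'I_m -> R) :
  x0 < x1 -> y0 < y1 ->
  continuous_on2 (`[x0, x1]%classic `*` `[y0, y1]%classic) f ->
  mixed_monge (`[x0, x1]%classic `*` `[y0, y1]%classic) f ->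
  convex_stencil w p -> convex_stencil v q ->
  (forall i, x0 <= p i <= x1) -> (forall j, y0 <= q j <= y1) ->
  \sum_(i < n) \sum_(j < m) w i * v j * f (p i) (q j) <= 0.
Proof.
move=> x01 y01 cf monge wp vq px qy.
apply: (@stencil_sum_limit _ _ _ w v (fun i j => f (p i) (q j))) => delta delta0.
have [d d0 dP] := rectangle_unif_continuous cf delta0.
(* Each node moves towards the centre by the fraction s of its distance. *)
near (0 : R)^'+ => s.
have s0 : 0 < s by [].
have s1 : s < 1 by near: s; exact: nbhs_right_lt.
have sx : s < d / (x1 - x0) by near: s; apply: nbhs_right_lt; rewrite divr_gt0 ?subr_gt0.
have sy : s < d / (y1 - y0) by near: s; apply: nbhs_right_lt; rewrite divr_gt0 ?subr_gt0.
have shrink (a b t : R) : a < b -> a <= t <= b -> s < d / (b - a) ->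
    let t' := (1 - s) * t + s * ((a + b) / 2) in a < t' < b /\ `|t - t'| < d.
  move=> ab /andP[h1 h2]; rewrite ltr_pdivlMr ?subr_gt0// => sd /=.
  have := mulr_ge0 (ltW s0) (_ : 0 <= t - a); rewrite subr_ge0 => /(_ h1) k1.
  have := mulr_ge0 (ltW s0) (_ : 0 <= b - t); rewrite subr_ge0 => /(_ h2) k2.
  have := mulr_ge0 (_ : 0 <= 1 - s) (_ : 0 <= t - a); rewrite !subr_ge0 => /(_ (ltW s1) h1) k3.
  have := mulr_ge0 (_ : 0 <= 1 - s) (_ : 0 <= b - t); rewrite !subr_ge0 => /(_ (ltW s1) h2) k4.
  have := mulr_gt0 s0 (_ : 0 < b - a); rewrite subr_gt0 => /(_ ab) k5.
  split; first by apply/andP; split; nra.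
  by rewrite ltr_norml; apply/andP; split; nra.
exists (fun i j => f ((1 - s) * p i + s * ((x0 + x1) / 2))
                     ((1 - s) * q j + s * ((y0 + y1) / 2))).
  move=> i j; have [/andP[a1 a2] a3] := shrink _ _ _ x01 (px i) sx.
  have [/andP[b1 b2] b3] := shrink _ _ _ y01 (qy j) sy.
  by apply/ltW/dP => //; rewrite !ltW.
apply: (monge_stencil_interior x01 y01 cf monge).
- exact: stencil_scale.
- exact: stencil_scale.
- by move=> i; have [] := shrink _ _ _ x01 (px i) sx.
- by move=> j; have [] := shrink _ _ _ y01 (qy j) sy.
Unshelve. all: by end_near. Qed.

(** * Convexity and concavity of the building blocks *)

Lemma convex_functionP (R : realType) (D : set R) (g : R -> R) :
  convex_function (D : set R^o) g <->
  forall a b t : R, D a -> D b -> 0 <= t <= 1 ->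
    g (t * a + (1 - t) * b) <= t * g a + (1 - t) * g b.
Proof.
split=> [cg a b t Da Db t01|cg t a b].
  have t01' : Itv.spec (@Itv.num_sem R) (Itv.Real `[0%Z, 1%Z]) t.
    by rewrite /Itv.spec/= /Itv.num_sem/= in_itv/= t01 andbT num_real.
  exact: (cg (Itv.mk t01') a b (mem_set Da) (mem_set Db)).
rewrite !inE => Da Db; apply: cg => //.
by apply/andP; split; [exact: ge0|exact: le1].
Qed.

Lemma concave_functionP (R : realType) (D : set R) (g : R -> R) :
  concave_function D g <->
  forall a b t : R, D a -> D b -> 0 <= t <= 1 ->
    t * g a + (1 - t) * g b <= g (t * a + (1 - t) * b).
Proof.
rewrite /concave_function convex_functionP.
by split=> cg a b t Da Db t01; have := cg a b t Da Db t01; lra.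
Qed.

Lemma green_concave (R : realType) (h : R) (n j : nat) (c : R) (D : set R) :
  concave_function D (fun y => green h n j (y - c)).
Proof.
apply/concave_functionP => a b t _ _ /andP[t0 t1]; rewrite /green.
set k := j.+1%:R * h; set l := j.+1%:R / n.+1%:R.
have t1' : 0 <= 1 - t by rewrite subr_ge0.
have -> : t * a + (1 - t) * b - c = t * (a - c) + (1 - t) * (b - c) by ring.
move: (a - c) (b - c) => {}a {}b.
suff : t * Num.min a k + (1 - t) * Num.min b k <= Num.min (t * a + (1 - t) * b) k.
  by lra.
rewrite le_min; apply/andP; split.
  by apply: lerD; apply: ler_wpM2l => //; rewrite ge_min lexx.
rewrite [leRHS](_ : k = t * k + (1 - t) * k); last by ring.
by apply: lerD; apply: ler_wpM2l => //; rewrite ge_min lexx orbT.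
Qed.

Lemma green_ge0 (R : realType) (h : R) (n j : nat) (t : R) :
  0 < h -> (j < n)%N -> 0 <= t <= n.+1%:R * h -> 0 <= green h n j t.
Proof.
move=> h0 jn /andP[t0 tL]; rewrite /green subr_ge0.
have n0 : 0 < n.+1%:R :> R by rewrite ltr0n.
have l1 : j.+1%:R / n.+1%:R <= 1 :> R.
  by rewrite ler_pdivrMr// mul1r ler_nat ltnS ltnW.
rewrite le_min; apply/andP; split.
  by rewrite -[leRHS]mulr1 ler_wpM2l.
rewrite mulrCA ler_wpM2l// ler_pdivrMr// mulrC; exact: tL.
Qed.

(** The stencil inequality for the Jensen defect in [x] and the symmetric second
    difference in [y]. *)
Lemma curvature_convex (R : realType) (x0 x1 y0 y1 : R) (f : R -> R -> R) (y h : R) :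
  y0 < y1 ->
  continuous_on2 (`[x0, x1]%classic `*` `[y0, y1]%classic) f ->
  mixed_monge (`[x0, x1]%classic `*` `[y0, y1]%classic) f ->
  y0 <= y <= y1 -> y0 <= y + h + h <= y1 ->
  convex_function (`[x0, x1]%classic : set R^o)
    (fun x => 2 * f x (y + h) - f x y - f x (y + h + h)).
Proof.
move=> y01 cf monge yY yhY; apply/convex_functionP => a b t /= + + t01.
rewrite !in_itv/= => aX bX.
(* A degenerate X consists of one point, where every function is convex. *)
have [x01|x10] := ltP x0 x1; last first.
  have -> : a = x0 by lra.
  have -> : b = x0 by lra.
  have tt v : t * v + (1 - t) * v = v by ring.
  by rewrite !tt.
have half : 0 <= (2^-1 : R) <= 1 by apply/andP; split; lra.
have := monge_stencil x01 y01 cf monge (jensen_stencil a b t01)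
  (jensen_stencil y (y + h + h) half).
have nodes (c d lo hi s : R) : lo <= c <= hi -> lo <= d <= hi -> 0 <= s <= 1 ->
    forall i, lo <= jensen_node s c d i <= hi.
  move=> /andP[c1 c2] /andP[d1 d2] /andP[s0 s1] i.
  have s1' : 0 <= 1 - s by rewrite subr_ge0.
  rewrite /jensen_node; case: i => -[|[|[|//]]] _ /=; rewrite ?c1 ?c2 ?d1 ?d2//.
  rewrite [lo in X in X && _](_ : lo = s * lo + (1 - s) * lo); last by ring.
  rewrite [hi in X in _ && X](_ : hi = s * hi + (1 - s) * hi); last by ring.
  by rewrite !lerD ?ler_wpM2l.
move=> /(_ (nodes _ _ _ _ _ aX bX t01) (nodes _ _ _ _ _ yY yhY half)).
pose G x := 2^-1 * f x y + (1 - 2^-1) * f x (y + h + h) - f x (y + h).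
under eq_bigr => i _.
  under eq_bigr => j _ do rewrite -mulrA.
  rewrite -mulr_sumr (jensen_sum _ _ _ (f (jensen_node t a b i))).
  rewrite (_ : 2^-1 * y + (1 - 2^-1) * (y + h + h) = y + h); last by field.
  rewrite -/(G _).
  over.
by rewrite (jensen_sum _ _ _ G) /G; lra.
Qed.

Lemma rectangle_bounded (R : realType) (x0 x1 y0 y1 : R) (f : R -> R -> R) :
  continuous_on2 (`[x0, x1]%classic `*` `[y0, y1]%classic) f ->
  exists M : R, forall x y, x0 <= x <= x1 -> y0 <= y <= y1 -> `|f x y| <= M.
Proof.
move=> cf.
have [M [Mr MP]] := compact_bounded (continuous_compact cf (@rectangle_compact _ x0 x1 y0 y1)).
exists (M + 1) => x y xX yY; apply: (MP (M + 1)); first by rewrite ltrDl.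
by exists (x, y) => //; split; rewrite /= in_itv.
Qed.

Lemma uniform_bound_ereal_sup (R : realType) (X Y : set R) (g : R -> R -> R) (eps : R) :
  0 < eps -> (forall x y, X x -> Y y -> `|g x y| <= eps / 2) ->
  (ereal_sup [set `|g x y|%:E | x in X & y in Y] < eps%:E)%E.
Proof.
move=> eps0 gle; apply: (@le_lt_trans _ _ (eps / 2)%:E); last by rewrite lte_fin; lra.
by apply: ge_ereal_sup => _ [x Xx [y Yy <-]]; rewrite lee_fin gle.
Qed.

(** * Approximation by sums of products *)

Theorem theorem1 (R : realType) (x0 x1 y0 y1 : R) (hx : x0 <= x1) (hy : y0 <= y1)
    (X : set R) (hX : X = `[x0, x1]%classic) (Y : set R) (hY : Y = `[y0, y1]%classic)
    (f : R -> R -> R)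
    (fcont : continuous_on2 (X `*` Y) f)
    (fconvex : forall y, Y y -> convex_function (X : set R^o) (f ^~ y))
    (fconcave : forall x, X x -> concave_function Y (f x))
    (fmonge : mixed_monge (X `*` Y) f)
    (eps : R) (eps_gt0 : 0 < eps) :
  exists (N : nat) (e a : 'I_N -> R -> R) (G : R -> R),
    [/\ (1 <= N)%N,
        forall i, convex_function (X : set R^o) (e i) /\
                  (forall x, X x -> 0 <= e i x),
        forall i, concave_function Y (a i) /\
                  (forall y, Y y -> 0 <= a i y),
        concave_function Y G
      & (ereal_sup [set `|f x y - (\sum_(i < N) e i x * a i y + G y)|%:E
                   | x in X & y in Y] < eps%:E)%E].
Proof.
subst X Y; have [C fC] := rectangle_bounded fcont.
have affine_concave (u v : R) D : concave_function D (fun y => u * y + v).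
  apply/concave_functionP => a b t _ _ _.
  by rewrite le_eqVlt; apply/orP; left; apply/eqP; ring.
have lift_convex y : y0 <= y <= y1 ->
    convex_function (`[x0, x1]%classic : set R^o) (fun x => f x y + C) /\
    (forall x, `[x0, x1]%classic x -> 0 <= f x y + C).
  move=> yY; split; last first.
    by move=> x; rewrite /= in_itv/= => xX; have := fC x y xX yY; rewrite ler_norml => /andP[]; lra.
  apply/convex_functionP => a b t aX bX t01.
  have yY' : `[y0, y1]%classic y by rewrite /= in_itv.
  by have /convex_functionP/(_ a b t aX bX t01) := fconvex y yY'; lra.
have [y01|y10] := ltP y0 y1; last first.
  (* If Y is one point, f depends on x only. *)
  exists 1%N, (fun _ x => f x y0 + C), (fun _ _ => 1), (fun _ => - C); split => //.
  - by move=> i; apply: lift_convex; rewrite lexx.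
  - move=> i; split=> [|y _]; last exact: ler01.
    have := affine_concave 0 1 `[y0, y1]%classic.
    by congr concave_function; apply/funext => y; rewrite mul0r add0r.
  - have := affine_concave 0 (- C) `[y0, y1]%classic.
    by congr concave_function; apply/funext => y; rewrite mul0r add0r.
  - apply: uniform_bound_ereal_sup => // x y _ /=; rewrite in_itv/= => yY.
    have -> : y = y0 by lra.
    by rewrite big_ord1 mulr1 addrK subrr normr0 divr_ge0 ?ltW.
have eps2 : 0 < eps / 2 by rewrite divr_gt0.
have [n _ /(_ n (leqnn n))/=] :=
  interpolant_approx (x0 := x0) (x1 := x1) y01 fcont eps2.
set h := _ / _ => approx.
have n0 : 0 < n.+1%:R :> R by rewrite ltr0n.
have h0 : 0 < h by rewrite divr_gt0 ?subr_gt0.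
have hn : n.+1%:R * h = y1 - y0 by rewrite mulrC divfK// gt_eqF.
(* The index j of a Green function stands for the interior node j.+1. *)
pose node (j : nat) : R := y0 + j%:R * h.
have nodeS j : node j.+1 = node j + h by rewrite /node -natr1; ring.
have node_in j : (j <= n.+1)%N -> y0 <= node j <= y1.
  move=> jn; rewrite /node lerDl mulr_ge0 ?(ltW h0)//= addrC -lerBrDr -hn.
  by rewrite ler_pM2r// ler_nat.
have nodeL : node n.+1 = y1 by rewrite /node hn; ring.
pose e (i : nat) (x : R) : R :=
  match i with
  | 0%N => f x y0 + C
  | 1%N => f x y1 + C
  | j.+2 => (2 * f x (node j.+1) - f x (node j) - f x (node j.+2)) / h
  end.
pose a (i : nat) (y : R) : R :=
  match i with
  | 0%N => 1 - (y - y0) / (y1 - y0)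
  | 1%N => (y - y0) / (y1 - y0)
  | j.+2 => green h n j (y - y0)
  end.
exists n.+2, (fun i => e i), (fun i => a i), (fun _ => - C); split => //.
- case=> -[|[|j]] jn /=; [apply: lift_convex; lra|apply: lift_convex; lra|].
  have hV : 0 <= h^-1 by rewrite invr_ge0 ltW.
  have jn1 : y0 <= node j <= y1 by apply: node_in; rewrite ltnW// ltnW.
  have jn2 : y0 <= node j.+2 <= y1 by exact: node_in.
  split.
    have jn3 : y0 <= node j + h + h <= y1 by rewrite -!nodeS.
    have /convex_functionP cc := curvature_convex y01 fcont fmonge jn1 jn3.
    apply/convex_functionP => u v t uX vX t01.
    have := ler_wpM2r hV (cc u v t uX vX t01).
    by rewrite -!nodeS; congr (_ <= _); rewrite /e; ring.
  move=> x xX; rewrite mulr_ge0//.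
  have /concave_functionP := fconcave x xX.
  have half : 0 <= (2^-1 : R) <= 1 by apply/andP; split; lra.
  move=> /(_ (node j) (node j.+2) 2^-1); rewrite /= !in_itv/=.
  move=> /(_ jn1 jn2 half).
  rewrite (_ : 2^-1 * node j + (1 - 2^-1) * node j.+2 = node j.+1); first by lra.
  by rewrite !nodeS; field.
- have L0 : 0 < y1 - y0 by rewrite subr_gt0.
  case=> -[|[|j]] jn /=.
  + split=> [|y]; rewrite /= ?in_itv/=; last first.
      by move=> /andP[y0y yy1]; rewrite subr_ge0 ler_pdivrMr// mul1r lerD2r.
    have := affine_concave (- (y1 - y0)^-1) (1 + y0 / (y1 - y0)) `[y0, y1]%classic.
    by congr concave_function; apply/funext => y; rewrite /a; ring.
  + split=> [|y]; rewrite /= ?in_itv/=; last first.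
      by move=> /andP[y0y yy1]; rewrite divr_ge0 ?subr_ge0.
    have := affine_concave ((y1 - y0)^-1) (- (y0 / (y1 - y0))) `[y0, y1]%classic.
    by congr concave_function; apply/funext => y; rewrite /a; ring.
  + split=> [|y]; first exact: green_concave.
    rewrite /= in_itv/= => /andP[y0y yy1]; apply: green_ge0 => //.
    by rewrite hn subr_ge0 y0y lerD2r.
- have := affine_concave 0 (- C) `[y0, y1]%classic.
  by congr concave_function; apply/funext => y; rewrite mul0r add0r.
- apply: uniform_bound_ereal_sup => // x y /=; rewrite !in_itv/= => xX yY.
  have := approx x y xX yY; rewrite distrC; congr (`|_| <= _); congr (_ - _).
  rewrite /interpolant !big_ord_recl /=.
  rewrite -/(node 0%N) -/(node n.+1) nodeL hn.
  have -> : node 0%N = y0 by rewrite /node mul0r addr0.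
  under eq_bigr => j _.
    rewrite /chord_slope -/(node j) -/(node j.+1) -/(node j.+2).
    over.
  have -> : \sum_(i < n) e (lift ord0 (lift ord0 i)) x * a (lift ord0 (lift ord0 i)) y
    = \sum_(j < n) ((f x (node j.+1) - f x (node j)) / h -
         (f x (node j.+2) - f x (node j.+1)) / h) * green h n j (y - y0).
    by apply: eq_bigr => j _ /=; congr (_ * _); ring.
  by ring.
Qed.
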